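(* Let $F$ be a species. For every finite set $U$ there is a bijection between $F^{\blacktriangleright}[U]$ and $\mathcal{T}_F[U]$, where $F^{\blacktriangleright}$ is the parking-like species over $F$ associated to the identity map and $\mathcal{T}_F$ is the tree-like species over $F$.
   Context: Species: a species $G$ assigns to each finite set $U$ a finite set $G[U]$ of structures (functorially in bijections). Sum: $(G+H)[U]=G[U]\sqcup H[U]$. Product: $(G\cdot H)[U]=\bigsqcup_{U=V\sqcup W}G[V]\times H[W]$. Powers: $G^0=\mathbf{1}$ (with $\mathbf{1}[U]=\{U\}$ if $U=\emptyset$, else $\emptyset$), $G^k=G\cdot G^{k-1}$. Restriction: $(G)_m[U]=G[U]$ if $|U|=m$, else $\emptyset$. Singleton species $X$: $X[U]=\{U\}$ if $|U|=1$, else $\emptyset$. Composition (for $H[\emptyset]=\emptyset$): a $G(H)$-structure on $U$ is a partition $\pi$ of $U$ together with a $G$-structure on the set of blocks of $\pi$ and an $H$-structure on each block. For a non-decreasing $\chi:\mathbb{N}_{>0}\to\mathbb{N}$, the parking-like species $F^{\chi}$ is defined recursively by $F^{\chi}:=\left(F^{\chi(1)}\right)_0+\sum_{m\ge1}\left(F^{\chi(1)}\right)_m\cdot F^{\rho_m}$ with $\rho_m:k\mapsto\chi(m+k)-\chi(1)$; $F^{\blacktriangleright}:=F^{\mathrm{Id}}$. The tree-like species $\mathcal{T}_F$ is the species defined by the recursive equation $\mathcal{T}_F=F(X\cdot\mathcal{T}_F)$. *)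

(* Defs.v *)
From mathcomp Require Import all_boot.

Set Implicit Arguments.
Unset Strict Implicit.
Unset Printing Implicit Defensive.

Record bij (U V : finType) := Bij {
  bij_fun :> U -> V;
  bij_inv : V -> U;
  bij_funK : cancel bij_fun bij_inv;
  bij_invK : cancel bij_inv bij_fun }.

Definition bij_id (U : finType) : bij U U :=
  @Bij U U id id (fun=> erefl) (fun=> erefl).

Definition bij_comp (U V W : finType) (t : bij V W) (s : bij U V) : bij U W :=
  @Bij U W (t \o s) (bij_inv s \o bij_inv t)
    (can_comp (bij_funK t) (bij_funK s))
    (can_comp (bij_invK s) (bij_invK t)).

Lemma bij_inj (U V : finType) (s : bij U V) : injective s.
Proof. exact: can_inj (bij_funK s). Qed.

Lemma bij_card (U V : finType) (s : bij U V) : #|U| = #|V|.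
Proof.
by apply: bij_eq_card; exists (bij_inv s); [exact: bij_funK|exact: bij_invK].
Qed.

(* [sp_ext] makes the transport depend only on the underlying function, since
   [bij] carries proofs and no functional extensionality is assumed. *)
Record species := Species {
  sp_obj :> finType -> finType;
  sp_map : forall U V : finType, bij U V -> sp_obj U -> sp_obj V;
  sp_ext : forall (U V : finType) (s t : bij U V),
    s =1 t -> sp_map s =1 sp_map t;
  sp_id : forall U : finType, sp_map (bij_id U) =1 id;
  sp_comp : forall (U V W : finType) (t : bij V W) (s : bij U V),
    sp_map (bij_comp t s) =1 sp_map t \o sp_map s }.

Arguments sp_map G [U V] s x : rename.

(* A subset, seen as a finite set in its own right. *)
Definition sub (U : finType) (A : {set U}) : finType := {x : U | x \in A}.

Lemma card_subT (U : finType) (A : {set U}) : #|sub A| = #|A|.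
Proof. by rewrite card_sig; apply: eq_card => x; rewrite inE. Qed.

Lemma bij_sub_inv (U V : finType) (s : bij U V) (A : {set U}) (B : {set V})
    (h : forall x, (s x \in B) = (x \in A)) :
  forall y, (bij_inv s y \in A) = (y \in B).
Proof. by move=> y; rewrite -h bij_invK. Qed.

Definition bij_sub (U V : finType) (s : bij U V) (A : {set U}) (B : {set V})
    (h : forall x, (s x \in B) = (x \in A)) : bij (sub A) (sub B).
Proof.
refine (@Bij (sub A) (sub B)
  (fun x => Sub (s (val x)) _) (fun y => Sub (bij_inv s (val y)) _) _ _).
- by move=> x; apply: val_inj; rewrite !SubK bij_funK.
- by move=> y; apply: val_inj; rewrite !SubK bij_invK.
Unshelve.
- by rewrite h; exact: valP.
- by rewrite (bij_sub_inv h); exact: valP.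
Defined.

Arguments bij_sub : simpl never.

Lemma val_bij_sub (U V : finType) (s : bij U V) A B h (x : sub A) :
  val (@bij_sub U V s A B h x) = s (val x).
Proof. by []. Qed.

Lemma val_bij_sub_inv (U V : finType) (s : bij U V) A B h (y : sub B) :
  val (bij_inv (@bij_sub U V s A B h) y) = bij_inv s (val y).
Proof. by []. Qed.

Definition bij_set (U V : finType) (s : bij U V) : bij {set U} {set V}.
Proof.
refine (@Bij {set U} {set V} (fun A => s @: A) (fun B => bij_inv s @: B) _ _).
- by move=> A; rewrite -imset_comp (eq_imset _ (bij_funK s)) imset_id.
- by move=> B; rewrite -imset_comp (eq_imset _ (bij_invK s)) imset_id.
Defined.

Lemma mem_bij_set (U V : finType) (s : bij U V) (A : {set U}) x :
  (s x \in bij_set s A) = (x \in A).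
Proof. exact: mem_imset (@bij_inj _ _ s). Qed.

Lemma mem_bij_setC (U V : finType) (s : bij U V) (A : {set U}) x :
  (s x \in ~: bij_set s A) = (x \in ~: A).
Proof. by rewrite !in_setC mem_bij_set. Qed.

Lemma bij_set_comp (U V W : finType) (t : bij V W) (s : bij U V) A :
  bij_set (bij_comp t s) A = bij_set t (bij_set s A).
Proof. by rewrite /= -imset_comp. Qed.

Lemma eq_bij_set (U V : finType) (s t : bij U V) :
  s =1 t -> bij_set s =1 bij_set t.
Proof. by move=> st A; exact: eq_imset. Qed.

Lemma bij_set_id (U : finType) : bij_set (bij_id U) =1 id.
Proof. by move=> A; exact: imset_id. Qed.

Lemma sp_compE (G : species) (U V W : finType) (t : bij V W) (s : bij U V) x :
  sp_map G t (sp_map G s x) = sp_map G (bij_comp t s) x.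
Proof. by rewrite sp_comp. Qed.

Definition sp_zero : species.
Proof.
refine (@Species (fun U => void) (fun U V s => id) _ _ _) => //.
Defined.

Definition sp_restr (G : species) (m : nat) : species.
Proof.
refine (@Species (fun U => {x : G U | #|U| == m})
  (fun U V s x => exist _ (sp_map G s (val x)) _) _ _ _).
- by move=> U V s t st x; apply: val_inj; exact: sp_ext.
- by move=> U x; apply: val_inj; exact: sp_id.
- by move=> U V W t s x; apply: val_inj; exact: sp_comp.
Unshelve.
by rewrite -(bij_card s); exact: valP x.
Defined.

Definition sp_unit : species.
Proof. by refine (@Species (fun U => unit) (fun U V s => id) _ _ _). Defined.

(* The structure {U} is encoded as [tt], so that [sp_one] and [sp_X] are the
   restrictions to sizes 0 and 1 of the one-structure-per-set species. *)
Definition sp_one : species := sp_restr sp_unit 0.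

Definition sp_X : species := sp_restr sp_unit 1.

Definition sp_add (G H : species) : species.
Proof.
refine (@Species (fun U => (G U + H U)%type)
  (fun U V s x => match x with
     | inl g => inl (sp_map G s g) | inr h => inr (sp_map H s h) end) _ _ _).
- by move=> U V s t st [g|h]; congr (_ _); exact: sp_ext.
- by move=> U [g|h]; congr (_ _); exact: sp_id.
- by move=> U V W t s [g|h]; congr (_ _); exact: sp_comp.
Defined.

(* In U = V + W the part W is the complement of V. *)
Definition prod_obj (G H : species) (U : finType) : finType :=
  {A : {set U} & (G (sub A) * H (sub (~: A)))%type}.

Definition prod_map (G H : species) (U V : finType) (s : bij U V)
    (x : prod_obj G H U) : prod_obj G H V :=
  existT _ (bij_set s (tag x))
    (sp_map G (bij_sub (mem_bij_set s (tag x))) (tagged x).1,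
     sp_map H (bij_sub (mem_bij_setC s (tag x))) (tagged x).2).

Lemma prod_eq (G H : species) (U : finType) (P Q : finType) (A B : {set U})
    (a1 : bij P (sub A)) (a2 : bij Q (sub (~: A)))
    (b1 : bij P (sub B)) (b2 : bij Q (sub (~: B))) g h :
  A = B -> (forall x, val (a1 x) = val (b1 x)) ->
  (forall x, val (a2 x) = val (b2 x)) ->
  existT _ A (sp_map G a1 g, sp_map H a2 h) =
  existT _ B (sp_map G b1 g, sp_map H b2 h) :> prod_obj G H U.
Proof.
move=> AB; case: B / AB b1 b2 => b1 b2 E1 E2.
by congr existT; congr pair; apply: sp_ext => x; apply: val_inj.
Qed.

Definition sp_prod (G H : species) : species.
Proof.
refine (@Species (prod_obj G H) (@prod_map G H) _ _ _).
- move=> U V s t st [A [g h]]; apply: prod_eq; first exact: eq_bij_set.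
  + by move=> x; rewrite !val_bij_sub st.
  + by move=> x; rewrite !val_bij_sub st.
- move=> U [A [g h]].
  rewrite -[g in RHS]sp_id -[h in RHS]sp_id.
  by apply: prod_eq => //; exact: bij_set_id.
- move=> U V W t s [A [g h]].
  rewrite /= /prod_map /= !sp_compE.
  by apply: prod_eq => //; exact: bij_set_comp.
Defined.

Fixpoint sp_pow (G : species) (k : nat) : species :=
  if k is k'.+1 then sp_prod G (sp_pow G k') else sp_one.

Lemma partition_bij_set (U V : finType) (s : bij U V) (P : {set {set U}}) :
  partition P [set: U] ->
  partition (bij_set (bij_set s) P) [set: V].
Proof.
suff -> : [set: V] = s @: [set: U] by rewrite (imset_partition _ _ (@bij_inj _ _ s)).
apply/esym/setP => y; rewrite inE; apply/imsetP.
by exists (bij_inv s y); rewrite ?inE ?bij_invK.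
Qed.

Definition parts (U : finType) : finType :=
  {P : {set {set U}} | partition P [set: U]}.

Definition parts_map (U V : finType) (s : bij U V) (P : parts U) : parts V :=
  exist _ (bij_set (bij_set s) (val P)) (partition_bij_set s (valP P)).

Definition block_fam (H : species) (U : finType) (P : parts U) : finType :=
  {dffun forall B : sub (val P), H (sub (val B))}.

(* Blocks of a [partition] are nonempty, so the value of H on empty sets plays no
   role and H[set0] = set0 need not be assumed. *)
Definition comp_obj (G H : species) (U : finType) : finType :=
  {P : parts U & (G (sub (val P)) * block_fam H P)%type}.

Definition blocks_bij (U V : finType) (s : bij U V) (P : parts U) :
    bij (sub (val P)) (sub (val (parts_map s P))) :=
  bij_sub (mem_bij_set (bij_set s) (val P)).

Lemma mem_block_inv (U V : finType) (s : bij U V) (P : parts U)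
    (C : sub (val (parts_map s P))) x :
  (s x \in val C) = (x \in val (bij_inv (blocks_bij s P) C)).
Proof. by rewrite val_bij_sub_inv -(mem_bij_set s) bij_invK. Qed.

Definition block_fam_map (H : species) (U V : finType) (s : bij U V)
    (P : parts U) (h : block_fam H P) : block_fam H (parts_map s P) :=
  [ffun C => sp_map H (bij_sub (mem_block_inv C))
               (h (bij_inv (blocks_bij s P) C))].

Lemma block_fam_mapE (H : species) (U V : finType) (s : bij U V)
    (P : parts U) (h : block_fam H P) (C : sub (val (parts_map s P))) :
  block_fam_map s h C = sp_map H (bij_sub (mem_block_inv C))
                          (h (bij_inv (blocks_bij s P) C)).
Proof. by rewrite ffunE. Qed.

Definition comp_map (G H : species) (U V : finType) (s : bij U V)
    (x : comp_obj G H U) : comp_obj G H V :=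
  let: existT P (g, h) := x in
  existT _ (parts_map s P) (sp_map G (blocks_bij s P) g, block_fam_map s h).

Lemma comp_eq (G H : species) (U : finType) (R : finType) (P Q : parts U)
    (a : bij R (sub (val P))) (b : bij R (sub (val Q))) g
    (h : block_fam H P) (k : block_fam H Q) :
  val P = val Q -> (forall x, val (a x) = val (b x)) ->
  (forall (B : sub (val P)) (C : sub (val Q)) (e : bij (sub (val B)) (sub (val C))),
     val B = val C -> (forall x, val (e x) = val x) -> k C = sp_map H e (h B)) ->
  existT _ P (sp_map G a g, h) = existT _ Q (sp_map G b g, k) :> comp_obj G H U.
Proof.
move/val_inj=> PQ; case: Q / PQ b k => b k Eab Ehk.
congr existT; congr pair; first by apply: sp_ext => x; apply: val_inj.
by apply/ffunP => B; rewrite (Ehk B B (bij_id _)) ?sp_id.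
Qed.

(* Reduces an equality between transports of h along different bijections to an
   equality of values in the ambient type. *)
Lemma fam_eq (H : species) (U W : finType) (P : parts U) (h : block_fam H P)
    (B B' : sub (val P)) (e : bij (sub (val B)) W) (e' : bij (sub (val B')) W) :
  val B = val B' ->
  (forall y, val (bij_inv e y) = val (bij_inv e' y)) ->
  sp_map H e (h B) = sp_map H e' (h B').
Proof.
move/val_inj=> BB'; case: B' / BB' e' => e' E; apply: sp_ext => x.
by apply: (can_inj (bij_invK e')); apply: val_inj; rewrite -E !bij_funK.
Qed.

Lemma comp_map_ext (G H : species) (U V : finType) (s t : bij U V) :
  s =1 t -> comp_map (G := G) (H := H) s =1 comp_map t.
Proof.
move=> st [P [g h]]; have st2 := eq_bij_set st.
apply: comp_eq.
- exact: (eq_bij_set st2).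
- by move=> B; exact: st2.
- move=> B C e BC eE; rewrite !block_fam_mapE sp_compE; apply: (fam_eq h).
    rewrite !val_bij_sub_inv; apply: (can_inj (bij_funK (bij_set t))).
    by rewrite bij_invK -st2 bij_invK.
  move=> y; apply: (@bij_inj _ _ t).
  rewrite val_bij_sub_inv bij_invK -st val_bij_sub_inv bij_invK.
  by rewrite -[y in LHS](bij_invK e) eE.
Qed.

Lemma comp_map_id (G H : species) (U : finType) :
  comp_map (G := G) (H := H) (bij_id U) =1 id.
Proof.
move=> [P [g h]]; rewrite -[g in RHS]sp_id; have id2 := @bij_set_id U.
apply/esym/comp_eq.
- by rewrite -[LHS]imset_id; apply/esym/eq_imset => A; exact: id2.
- by move=> B; exact/esym/id2.
- move=> B C e BC eE; rewrite block_fam_mapE; apply: (fam_eq h).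
    by rewrite val_bij_sub_inv BC; exact: imset_id.
  move=> y; rewrite val_bij_sub_inv.
  by rewrite -[y in LHS](bij_invK e) eE.
Qed.

Lemma comp_map_comp (G H : species) (U V W : finType)
    (t : bij V W) (s : bij U V) :
  comp_map (G := G) (H := H) (bij_comp t s) =1 comp_map t \o comp_map s.
Proof.
move=> [P [g h]]; have cE := bij_set_comp t s.
rewrite [RHS]/comp [LHS]/comp_map [in RHS]/comp_map sp_compE; apply: comp_eq.
- by rewrite /= -imset_comp; apply: eq_imset => A; exact: cE.
- by move=> B; exact: cE.
- move=> B C e BC eE; rewrite !block_fam_mapE !sp_compE; apply: (fam_eq h).
    by rewrite !val_bij_sub_inv BC; exact/esym/imset_comp.
  by move=> y; rewrite -[y in LHS](bij_invK e) !val_bij_sub_inv eE.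
Qed.

Definition sp_compose (G H : species) : species :=
  @Species (comp_obj G H) (@comp_map G H) (@comp_map_ext G H)
    (@comp_map_id G H) (@comp_map_comp G H).

(* The species whose value on U is that of (G #|U|): used to pass to the limit
   in a sequence of species that is stationary on sets of bounded size. *)
Definition diag_map (G : nat -> species) (U V : finType) (s : bij U V)
    (x : G #|U| U) : G #|V| V :=
  ecast n (G n V) (bij_card s) (sp_map (G #|U|) s x).

Lemma diag_mapE (G : nat -> species) (U V : finType) (s : bij U V) n
    (eU : #|U| = n) (eV : #|V| = n) x :
  ecast n (G n V) eV (diag_map (G := G) s x) =
  sp_map (G n) s (ecast n (G n U) eU x).
Proof.
rewrite /diag_map; move: (bij_card s) => e.
case: n / eU eV => eV /=; move: (sp_map _ _ _) => y.
by case: _ / e y eV => y eV; rewrite eq_axiomK.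
Qed.

Definition sp_diag (G : nat -> species) : species.
Proof.
refine (@Species (fun U => G #|U| U) (@diag_map G) _ _ _).
- move=> U V s t st x; rewrite /diag_map (sp_ext st).
  by rewrite (eq_irrelevance (bij_card s) (bij_card t)).
- by move=> U x; rewrite /diag_map eq_axiomK sp_id.
- move=> U V W t s x /=.
  have h := diag_mapE (G := G) t (bij_card t) erefl (diag_map s x).
  rewrite /= in h; rewrite h {h}.
  have h := diag_mapE (G := G) s (bij_card (bij_comp t s)) (bij_card t) x.
  rewrite h {h}; have h := diag_mapE (G := G) (bij_comp t s) (bij_card (bij_comp t s)) erefl x.
  by rewrite /= in h; rewrite h sp_comp.
Defined.

Definition sp_fsum (n : nat) (G : nat -> species) : species.
Proof.
refine (@Species (fun U => {m : 'I_n & G m U})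
  (fun U V s x => existT _ (tag x) (sp_map (G (tag x)) s (tagged x))) _ _ _).
- by move=> U V s t st [m x]; congr existT; exact: sp_ext.
- by move=> U [m x]; congr existT; exact: sp_id.
- by move=> U V W t s [m x]; congr existT; exact: sp_comp.
Defined.

(* The sum of the (G m), m >= 1, for a family with (G m)[U] empty when m > #|U|,
   so that on U only the terms 1 <= m <= #|U| contribute. *)
Definition sp_sum_ge1 (G : nat -> species) : species :=
  sp_diag (fun n => sp_fsum n (fun m => G m.+1)).

Lemma restr_prod_empty (G H : species) (m : nat) (U : finType) :
  #|U| < m -> sp_prod (sp_restr G m) H U -> False.
Proof.
move=> ltUm [A [g _]]; have := valP g; rewrite card_subT => /eqP cA.
by move: ltUm; rewrite -cA ltnNge max_card.
Qed.

(* chi is only evaluated at positive arguments; the subtraction is never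
   truncated when chi is non-decreasing. *)
Definition rho (chi : nat -> nat) (m : nat) : nat -> nat :=
  fun k => chi (m + k) - chi 1.

(* The right-hand side of the recursive definition of the parking-like species,
   with P standing for the family chi |-> F^chi. *)
Definition parking_rhs (F : species) (P : (nat -> nat) -> species)
    (chi : nat -> nat) : species :=
  sp_add (sp_restr (sp_pow F (chi 1)) 0)
    (sp_sum_ge1 (fun m =>
       sp_prod (sp_restr (sp_pow F (chi 1)) m) (P (rho chi m)))).

Fixpoint parking_iter (F : species) (n : nat) : (nat -> nat) -> species :=
  if n is n'.+1 then parking_rhs F (parking_iter F n') else fun=> sp_zero.

(* A structure on U involves at most #|U| + 1 unfoldings of the recursion, since
   each one uses up at least one point; see [parkingE]. *)
Definition parking (F : species) (chi : nat -> nat) : species :=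
  sp_diag (fun n => parking_iter F n.+1 chi).

Definition treelike_rhs (F T : species) : species :=
  sp_compose F (sp_prod sp_X T).

Fixpoint treelike_iter (F : species) (n : nat) : species :=
  if n is n'.+1 then treelike_rhs F (treelike_iter F n') else sp_zero.

(* Solution of T = F(X.T), see [treelikeE]. *)
Definition treelike (F : species) : species :=
  sp_diag (fun n => treelike_iter F n.+1).

(* Natural isomorphism between the restrictions of G and H to the finite sets
   whose size satisfies p. *)
Record iso_on (p : pred nat) (G H : species) := IsoOn {
  iso_bij : forall U : finType, p #|U| -> bij (G U) (H U);
  iso_nat : forall (U V : finType) (s : bij U V) (pU : p #|U|) (pV : p #|V|) x,
    iso_bij pV (sp_map G s x) = sp_map H s (iso_bij pU x) }.

Definition species_iso (G H : species) := iso_on predT G H.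

Definition iso_refl (p : pred nat) (G : species) : iso_on p G G :=
  @IsoOn p G G (fun U _ => bij_id (G U)) (fun _ _ _ _ _ _ => erefl).

Definition iso_void (p : pred nat) (G H : species) :
  (forall n, ~~ p n) -> iso_on p G H.
Proof.
move=> p0; refine (@IsoOn p G H
  (fun U pU => False_rect _ (negP (p0 #|U|) pU)) _).
by move=> U V s pU; case: (negP (p0 _) pU).
Defined.

Definition iso_sub (p q : pred nat) (G H : species) :
  subpred q p -> iso_on p G H -> iso_on q G H.
Proof.
move=> qp I; refine (@IsoOn q G H (fun U qU => iso_bij I (qp _ qU)) _).
by move=> *; exact: iso_nat.
Defined.

Definition iso_add (p : pred nat) (G G' H H' : species) :
  iso_on p G G' -> iso_on p H H' -> iso_on p (sp_add G H) (sp_add G' H').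
Proof.
move=> I J; unshelve refine (@IsoOn p (sp_add G H) (sp_add G' H')
  (fun U pU => @Bij (sp_add G H U) (sp_add G' H' U)
    (fun x => match x with
       inl g => inl (iso_bij I pU g) | inr h => inr (iso_bij J pU h) end)
    (fun x => match x with
       inl g => inl (bij_inv (iso_bij I pU) g)
     | inr h => inr (bij_inv (iso_bij J pU) h) end) _ _) _).
- by move=> [g|h]; rewrite bij_funK.
- by move=> [g|h]; rewrite bij_invK.
- by move=> U V s pU pV [g|h] /=; rewrite (iso_nat _ s pU pV).
Defined.

Definition iso_fsum (p : pred nat) (n : nat) (G H : nat -> species) :
  (forall m, iso_on p (G m) (H m)) -> iso_on p (sp_fsum n G) (sp_fsum n H).
Proof.
move=> I; unshelve refine (@IsoOn p (sp_fsum n G) (sp_fsum n H)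
  (fun U pU => @Bij (sp_fsum n G U) (sp_fsum n H U)
    (fun x => existT _ (tag x) (iso_bij (I (tag x)) pU (tagged x)))
    (fun x => existT _ (tag x) (bij_inv (iso_bij (I (tag x)) pU) (tagged x)))
    _ _) _).
- by move=> [m x] /=; rewrite bij_funK.
- by move=> [m x] /=; rewrite bij_invK.
- by move=> U V s pU pV [m x] /=; rewrite (iso_nat _ s pU pV).
Defined.

Definition iso_diag_l (p : pred nat) (G : nat -> species) (H : species) :
  (forall n, iso_on [pred k | (k == n) && p k] (G n) H) ->
  iso_on p (sp_diag G) H.
Proof.
move=> I; have pE (U : finType) : p #|U| -> [pred k | (k == #|U|) && p k] #|U|.
  by move=> pU; rewrite inE eqxx.
refine (@IsoOn p (sp_diag G) H (fun U pU => iso_bij (I #|U|) (pE U pU)) _).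
move=> U V s pU pV x /=; rewrite /diag_map.
suff gen n (e : #|U| = n) (qU : [pred k | (k == #|U|) && p k] #|U|)
    (qV : [pred k | (k == n) && p k] #|V|) :
    iso_bij (I n) qV (ecast n (G n V) e (sp_map (G #|U|) s x)) =
    sp_map H s (iso_bij (I #|U|) qU x) by exact: gen.
by case: n / e qV => qV; exact: iso_nat.
Defined.

Definition iso_diag_r (p : pred nat) (G : species) (H : nat -> species) :
  (forall n, iso_on [pred k | (k == n) && p k] G (H n)) ->
  iso_on p G (sp_diag H).
Proof.
move=> I; have pE (U : finType) : p #|U| -> [pred k | (k == #|U|) && p k] #|U|.
  by move=> pU; rewrite inE eqxx.
refine (@IsoOn p G (sp_diag H) (fun U pU => iso_bij (I #|U|) (pE U pU)) _).
move=> U V s pU pV x /=; rewrite /diag_map.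
suff gen n (e : #|U| = n) (qU : [pred k | (k == #|U|) && p k] #|U|)
    (qV : [pred k | (k == n) && p k] #|V|) :
    iso_bij (I n) qV (sp_map G s x) =
    ecast n (H n V) e (sp_map (H #|U|) s (iso_bij (I #|U|) qU x)) by exact: gen.
by case: n / e qV => qV; exact: iso_nat.
Defined.

Definition iso_diag (p : pred nat) (G H : nat -> species) :
  (forall n, iso_on p (G n) (H n)) -> iso_on p (sp_diag G) (sp_diag H).
Proof.
move=> I; refine (@IsoOn p (sp_diag G) (sp_diag H)
  (fun U pU => iso_bij (I #|U|) pU) _).
move=> U V s pU pV x /=; rewrite /diag_map.
suff gen n (e : #|U| = n) :
    iso_bij (I n) pV (ecast n (G n V) e (sp_map (G #|U|) s x)) =
    ecast n (H n V) e (sp_map (H #|U|) s (iso_bij (I #|U|) pU x)) by exact: gen.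
by case: n / e; exact: iso_nat.
Defined.

Definition iso_prod_r (p q : pred nat) (G H H' : species) :
  (forall (U : finType) (A : {set U}),
     p #|U| -> G (sub A) -> q #|sub (~: A)|) ->
  iso_on q H H' -> iso_on p (sp_prod G H) (sp_prod G H').
Proof.
move=> pq I; unshelve refine (@IsoOn p (sp_prod G H) (sp_prod G H')
  (fun U pU => @Bij (sp_prod G H U) (sp_prod G H' U)
    (fun x => let: existT A (g, h) := x in
       existT _ A (g, iso_bij I (pq U A pU g) h))
    (fun x => let: existT A (g, h) := x in
       existT _ A (g, bij_inv (iso_bij I (pq U A pU g)) h)) _ _) _).
- by move=> [A [g h]]; rewrite bij_funK.
- by move=> [A [g h]]; rewrite bij_invK.
- move=> U V s pU pV [A [g h]] /=; rewrite /prod_map /=.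
  by congr existT; congr pair; exact: iso_nat.
Defined.

Definition iso_compose_r (p q : pred nat) (G H H' : species) :
  (forall (U : finType) (A : {set U}), p #|U| -> q #|sub A|) ->
  iso_on q H H' -> iso_on p (sp_compose G H) (sp_compose G H').
Proof.
move=> pq I.
pose fwd (U : finType) (pU : p #|U|) (P : parts U) (h : block_fam H P) :
  block_fam H' P := [ffun B => iso_bij I (pq U (val B) pU) (h B)].
pose bwd (U : finType) (pU : p #|U|) (P : parts U) (h : block_fam H' P) :
  block_fam H P := [ffun B => bij_inv (iso_bij I (pq U (val B) pU)) (h B)].
have fwdE U pU P h B : @fwd U pU P h B = iso_bij I (pq U (val B) pU) (h B).
  by rewrite ffunE.
have bwdE U pU P h B :
    @bwd U pU P h B = bij_inv (iso_bij I (pq U (val B) pU)) (h B).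
  by rewrite ffunE.
clearbody fwd bwd.
unshelve refine (@IsoOn p (sp_compose G H) (sp_compose G H')
  (fun U pU => @Bij (sp_compose G H U) (sp_compose G H' U)
    (fun x => let: existT P (g, h) := x in existT _ P (g, fwd U pU P h))
    (fun x => let: existT P (g, h) := x in existT _ P (g, bwd U pU P h))
    _ _) _).
- move=> [P [g h]]; congr existT; congr pair; apply/ffunP => B.
  by rewrite bwdE fwdE bij_funK.
- move=> [P [g h]]; congr existT; congr pair; apply/ffunP => B.
  by rewrite fwdE bwdE bij_invK.
- move=> U V s pU pV [P [g h]].
  rewrite [sp_map (sp_compose G H) s]/sp_map /sp_compose /comp_map.
  congr existT; congr pair; apply/ffunP => B.
  by rewrite fwdE !block_fam_mapE fwdE; exact: iso_nat.
Defined.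

Definition parking_rhs_iso (F : species) (P Q : (nat -> nat) -> species) n :
  (forall chi, iso_on (ltn^~ n) (P chi) (Q chi)) ->
  forall chi, iso_on (ltn^~ n.+1) (parking_rhs F P chi) (parking_rhs F Q chi).
Proof.
move=> I chi; apply: iso_add; first exact: iso_refl.
apply: iso_diag => k; apply: iso_fsum => m; apply: iso_prod_r (I _).
move=> U A ltU g; have := valP g; rewrite !card_subT => /eqP cA /=.
have := cardsC A; rewrite cA => cU; rewrite /= -cU addSn ltnS in ltU.
exact: leq_ltn_trans (leq_addl _ _) ltU.
Defined.

Definition parking_iter_iso (F : species) n k :
  forall chi, iso_on (ltn^~ (minn n k))
    (parking_iter F n chi) (parking_iter F k chi).
Proof.
elim: n k => [|n IHn] [|k] chi; try by apply: iso_void => i; rewrite ?min0n ?minn0.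
by rewrite minnSS; apply: parking_rhs_iso.
Defined.

Lemma parkingE (F : species) (chi : nat -> nat) :
  species_iso (parking F chi) (parking_rhs F (parking F) chi).
Proof.
apply: iso_diag_l => n.
apply: (@iso_sub (ltn^~ n.+1)); first by move=> k /= /andP[/eqP-> _].
apply: parking_rhs_iso => psi; apply: iso_diag_r => k.
apply: iso_sub (parking_iter_iso F n k.+1 psi) => i /= /andP[/eqP-> ltkn].
by rewrite leq_min ltkn ltnSn.
Qed.

Definition treelike_rhs_iso (F S T : species) n :
  iso_on (ltn^~ n) S T ->
  iso_on (ltn^~ n.+1) (treelike_rhs F S) (treelike_rhs F T).
Proof.
move=> I; apply: (@iso_compose_r _ (ltn^~ n.+1)).
  by move=> U A /=; rewrite !ltnS card_subT; exact: leq_trans (max_card _).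
apply: iso_prod_r I => U A ltU x.
have := valP x; rewrite !card_subT => /eqP cA.
by have := cardsC A; rewrite cA add1n => cU; rewrite /= -cU ltnS in ltU.
Defined.

Definition treelike_iter_iso (F : species) n k :
  iso_on (ltn^~ (minn n k)) (treelike_iter F n) (treelike_iter F k).
Proof.
elim: n k => [|n IHn] [|k]; try by apply: iso_void => i; rewrite ?min0n ?minn0.
by rewrite minnSS; apply: treelike_rhs_iso.
Defined.

Lemma treelikeE (F : species) :
  species_iso (treelike F) (sp_compose F (sp_prod sp_X (treelike F))).
Proof.
apply: iso_diag_l => n.
apply: (@iso_sub (ltn^~ n.+1)); first by move=> k /= /andP[/eqP-> _].
apply: treelike_rhs_iso; apply: iso_diag_r => k.
apply: iso_sub (treelike_iter_iso F n k.+1) => i /= /andP[/eqP-> ltkn].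
by rewrite leq_min ltkn ltnSn.
Qed.

(* Main.v *)
(** Only cardinalities matter. Let [f] and [t] be the exponential generating
    series of [F] and of the tree-like species, so that [t = f(x t)]. Hence
    [t^c = f^c(x t) = sum_m [x^m] f^c . x^m t^m], which is exactly the recursion
    satisfied by the series of [F^chi] for [chi k = c + k - 1], because
    [rho_m] is then [k |-> m + k - 1] whatever [c] is. So [F^chi] and the
    [c]-th power of the tree-like species are equinumerous, and [c = 1] is the
    theorem. Series are truncated to polynomials over [rat]. *)
Require Import Defs.
From mathcomp Require Import all_boot.
From mathcomp Require Import all_order all_algebra.
From mathcomp Require Import ring.

Set Implicit Arguments.
Unset Strict Implicit.
Unset Printing Implicit Defensive.

Import GRing.Theory Num.Theory.

(** * Sums over subsets and over set partitions *)

Section SetSums.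
Local Open Scope ring_scope.
Variable R : numFieldType.

Lemma fact_neq0 n : n`!%:R != 0 :> R.
Proof. by rewrite pnatr_eq0 -lt0n fact_gt0. Qed.

Lemma leq_card_blocks (U : finType) (P : {set {set U}}) (D : {set U}) :
  partition P D -> (#|P| <= #|D|)%N.
Proof.
move=> pP; rewrite (card_partition pP) -sum1_card.
by apply: leq_sum => B BP; rewrite card_gt0 (partition_neq0 pP BP).
Qed.

Lemma sum_subsets_by_card (V : nmodType) (U : finType) (D : {set U})
    (c : nat -> V) :
  \sum_(A : {set U} | A \subset D) c #|A| =
  \sum_(j < #|D|.+1) c j *+ 'C(#|D|, j).
Proof.
rewrite (partition_big (fun A : {set U} => inord #|A|)
  (fun j : 'I_#|D|.+1 => true)) //.
apply: eq_bigr => j _; rewrite -cards_draws -sumr_const.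
apply: congr_big => // A; last first.
  move=> /andP[sAD /eqP jE]; congr c; move/(congr1 val): jE.
  by rewrite /= inordK // ltnS subset_leq_card.
rewrite inE; case sAD: (A \subset D) => //=.
by rewrite -val_eqE /= inordK // ltnS subset_leq_card.
Qed.

(* Sums over subsets become Cauchy products after dividing by factorials. *)
Lemma sum_subsets_conv (U : finType) (D : {set U}) (a b : nat -> R) :
  (\sum_(A : {set U} | A \subset D) a #|A| * b #|D :\: A|) / #|D|`!%:R =
  \sum_(j < #|D|.+1) a j / j`!%:R * (b (#|D| - j)%N / (#|D| - j)`!%:R).
Proof.
under eq_bigr => A sAD do rewrite cardsD (setIidPr sAD).
rewrite (sum_subsets_by_card D (fun j => a j * b (#|D| - j)%N)) mulr_suml.
apply: eq_bigr => j _; have lejD : (j <= #|D|)%N by rewrite -ltnS.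
rewrite -(bin_fact lejD) !natrM -mulr_natr.
have : 'C(#|D|, j)%:R != 0 :> R by rewrite pnatr_eq0 -lt0n bin_gt0.
move: (fact_neq0 j) (fact_neq0 (#|D| - j)) => h1 h2 h3.
by field; rewrite h1 h2 h3.
Qed.

(** The partial Bell polynomial of index [(#|D|, k)] in the variables [h 1, h 2, ...]. *)
Definition partition_weight (h : nat -> R) (U : finType) (k : nat)
    (D : {set U}) : R :=
  \sum_(P : {set {set U}} | partition P D && (#|P| == k))
    \prod_(B in P) h #|B|.

(* Double counting of partitions with a marked block. *)
Lemma partition_weightS (h : nat -> R) (U : finType) k (D : {set U}) :
  h 0%N = 0 ->
  partition_weight h k.+1 D *+ k.+1 =
  \sum_(A : {set U} | A \subset D) h #|A| * partition_weight h k (D :\: A).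
Proof.
move=> h0; rewrite /partition_weight.
(* Blocks are nonempty, so the term [A = set0] must go; [h 0 = 0] removes it. *)
transitivity (\sum_(A : {set U} | (A \subset D) && (A != set0))
    h #|A| * partition_weight h k (D :\: A)); last first.
  rewrite [RHS](bigID (fun A => A == set0)) /= [X in _ = X + _]big1 ?add0r //.
  by move=> A /andP[_ /eqP->]; rewrite cards0 h0 mul0r.
under [RHS]eq_bigr => A _ do rewrite /partition_weight big_distrr /=.
rewrite -sumrMnl.
(* The factor [k.+1] becomes the choice of a marked block of [P]. *)
under [LHS]eq_bigr => P /andP[_ /eqP <-] do rewrite -sumr_const.
rewrite !pair_big_dep /=.
(* A partition with a marked block corresponds to that block together with a partition of the
   remaining points. *)
rewrite (reindex_onto (fun q : {set U} * {set {set U}} => (q.1 |: q.2, q.1))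
  (fun p : {set {set U}} * {set U} => (p.2, p.1 :\ p.2))) /=; last first.
  by move=> [P B] /= /andP[_ BP]; rewrite setD1K.
apply: congr_big => // -[A P] /=; last first.
  move=> /andP[/andP[/andP[pAP _] _] /eqP[PE]]; rewrite big_setU1 //.
  by rewrite -PE !inE eqxx.
rewrite setU11 andbT xpair_eqE eqxx /=.
apply/andP/andP.
  move=> [/andP[pAP cAP] /eqP PE]; have AAP : A \in A |: P by exact: setU11.
  have AP : A \notin P by rewrite -PE !inE eqxx.
  rewrite (partitionS pAP AAP) (partition_neq0 pAP AAP); split => //.
  rewrite -PE (partitionD1 pAP AAP) PE /=.
  by move: cAP; rewrite cardsU1 AP.
move=> [/andP[sAD A0] /andP[pP /eqP cP]].
(* A block of a partition of [D :\: A] is disjoint from [A], so [A] itself could be one only if it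
   were empty. *)
have AP : A \notin P.
  apply/negP => AP; have := partitionS pP AP.
  by rewrite subsetD -setI_eq0 setIid (negPf A0) andbF.
rewrite cardsU1 AP cP eqxx setU1K // eqxx; split => //; rewrite andbT.
rewrite -(setID D A) (setIidPr sAD); apply: partitionU1 => //.
by rewrite -setI_eq0 setDE setICA setICr setI0.
Qed.

(** The factor [k!] orders the blocks. By induction on [k], marking a block gives the Cauchy product
    that computes [q * q ^+ k]. *)
Lemma partition_weight_coef (h : nat -> R) (q : {poly R}) (N : nat)
    (U : finType) :
  h 0%N = 0 -> (forall j, (j < N)%N -> q`_j = h j / j`!%:R) ->
  forall k (D : {set U}), (#|D| < N)%N ->
  partition_weight h k D * k`!%:R / #|D|`!%:R = (q ^+ k)`_#|D|.
Proof.
move=> h0 qE; elim=> [|k IHk] D ltDN.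
  rewrite expr0 coef1 fact0 mulr1 /partition_weight.
  have [/eqP D0|D0] := eqVneq #|D| 0%N.
    move: D0; rewrite cards_eq0 => /eqP->.
    rewrite (big_pred1 set0) => [|P]; last first.
      by rewrite partition_set0 cards_eq0 andbb.
    by rewrite big_set0 cards0 fact0 divr1.
  rewrite big_pred0 ?mul0r // => P; apply/negP => /andP[pP].
  rewrite cards_eq0 => /eqP P0; case/negP: D0.
  by rewrite (card_partition pP) P0 big_set0.
(* The weight that the induction hypothesis forces on a set of [m] points; being a function of [m]
   alone, it fits [sum_subsets_conv]. *)
pose b m := (q ^+ k)`_m * m`!%:R / k`!%:R.
have wE (A : {set U}) : A \subset D ->
    partition_weight h k (D :\: A) = b #|D :\: A|.
  move=> sAD; rewrite /b -IHk; last first.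
    by apply: leq_ltn_trans ltDN; exact/subset_leq_card/subsetDl.
  by move: (fact_neq0 k) (fact_neq0 #|D :\: A|) => h1 h2; field; rewrite h1 h2.
rewrite factS natrM mulrA [_ * k.+1%:R]mulr_natr partition_weightS // mulrAC.
under eq_bigr => A sAD do rewrite wE //.
rewrite sum_subsets_conv mulr_suml exprS coefM; apply: eq_bigr => j _.
rewrite qE; last by apply: leq_ltn_trans ltDN; rewrite -ltnS.
rewrite /b; move: (fact_neq0 k) (fact_neq0 j) (fact_neq0 (#|D| - j)).
by move=> h1 h2 h3; field; rewrite h1 h2 h3.
Qed.

End SetSums.


(** * Cardinalities of the species constructions *)

Section Counting.
Local Open Scope ring_scope.

(** The sets ['I_n] serve as representatives: by functoriality every set of [n] points carries the
    same number of structures, see [card_species]. *)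
Definition sp_count (G : species) (n : nat) : nat := #|G 'I_n|.

Definition sp_map_bij (G : species) (U V : finType) (s : bij U V) :
  bij (G U) (G V).
Proof.
pose s' := @Bij V U (bij_inv s) s (bij_invK s) (bij_funK s).
refine (@Bij (G U) (G V) (sp_map G s) (sp_map G s') _ _) => x.
- rewrite sp_compE -[RHS]sp_id; apply: sp_ext => y; exact: bij_funK.
- rewrite sp_compE -[RHS]sp_id; apply: sp_ext => y; exact: bij_invK.
Defined.

Lemma card_species (G : species) (U : finType) : #|G U| = sp_count G #|U|.
Proof.
pose s := @Bij U 'I_#|U| _ _ (@enum_rankK U) (@enum_valK U).
exact: bij_card (sp_map_bij G s).
Qed.

Lemma card_species_sub (G : species) (U : finType) (A : {set U}) :
  #|G (sub A)| = sp_count G #|A|.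
Proof. by rewrite card_species card_subT. Qed.

Lemma card_iso (G H : species) (U : finType) :
  species_iso G H -> #|G U| = #|H U|.
Proof. by move=> I; exact: bij_card (iso_bij I (isT : predT #|U|)). Qed.

Lemma card_sigma (I : finType) (T : I -> finType) :
  #|{: {i : I & T i}}| = (\sum_i #|T i|)%N.
Proof. by rewrite card_tagged sumnE big_map big_enum. Qed.

Lemma card_prod_species (G H : species) (U : finType) :
  #|sp_prod G H U| =
  (\sum_(A : {set U}) sp_count G #|A| * sp_count H #|~: A|)%N.
Proof.
rewrite card_sigma; apply: eq_bigr => A _.
by rewrite card_prod !card_species_sub.
Qed.

Lemma count_restr (G : species) m n :
  sp_count (sp_restr G m) n = if n == m then sp_count G n else 0%N.
Proof.
rewrite /sp_count card_sig card_ord; case: ifP => _.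
  by apply: eq_card => x; rewrite !inE.
by apply: eq_card0 => x; rewrite !inE.
Qed.

Lemma card_compose (G H : species) (U : finType) :
  #|sp_compose G H U| =
  (\sum_(P : {set {set U}} | partition P [set: U])
     sp_count G #|P| * \prod_(B in P) sp_count H #|B|)%N.
Proof.
rewrite card_sigma -[RHS]/(\sum_(P in [pred P | partition P [set: U]]) _)%N.
rewrite [RHS]big_sub; apply: eq_bigr => P _.
rewrite card_prod card_species_sub; congr (_ * _)%N.
rewrite card_dep_ffun [RHS](big_sub [pred B | B \in val P]).
rewrite foldrE big_map big_enum; apply: eq_bigr => B _.
exact: card_species_sub.
Qed.

Lemma card_parking (F : species) (chi : nat -> nat) (U : finType) :
  #|parking F chi U| =
  (sp_count (sp_restr (sp_pow F (chi 1)) 0) #|U| +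
   \sum_(m < #|U|) \sum_(A : {set U})
     sp_count (sp_restr (sp_pow F (chi 1)) m.+1) #|A| *
     sp_count (parking F (rho chi m.+1)) #|~: A|)%N.
Proof.
rewrite (card_iso U (parkingE F chi)) card_sum card_species; congr (_ + _)%N.
rewrite card_sigma; apply: eq_bigr => m _; exact: card_prod_species.
Qed.

End Counting.

(** * Exponential generating functions, truncated at order [N] *)

Section GeneratingFunctions.
Local Open Scope ring_scope.

(** Congruence modulo ['X^N]. *)
Definition eq_upto (N : nat) (p q : {poly rat}) :=
  forall i, (i < N)%N -> p`_i = q`_i.

Lemma eq_uptoM N p p' q q' :
  eq_upto N p p' -> eq_upto N q q' -> eq_upto N (p * q) (p' * q').
Proof.
move=> pE qE i ltiN; rewrite !coefM; apply: eq_bigr => j _.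
rewrite pE ?qE //; first exact: leq_ltn_trans (leq_subr _ _) ltiN.
by apply: leq_ltn_trans ltiN; rewrite -ltnS.
Qed.

Lemma eq_uptoX N p q k : eq_upto N p q -> eq_upto N (p ^+ k) (q ^+ k).
Proof.
by move=> pq; elim: k => [|k IHk]; rewrite ?expr0 // !exprS; exact: eq_uptoM.
Qed.

Lemma eq_upto_comp N f p q : eq_upto N p q -> eq_upto N (f \Po p) (f \Po q).
Proof.
move=> pq i ltiN; rewrite !coef_comp_poly; apply: eq_bigr => j _.
by rewrite (eq_uptoX _ pq).
Qed.

Definition egf (N : nat) (G : species) : {poly rat} :=
  \poly_(n < N) ((sp_count G n)%:R / n`!%:R).

Lemma coef_egf N G n : (n < N)%N -> (egf N G)`_n = (sp_count G n)%:R / n`!%:R.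
Proof. by move=> ltnN; rewrite coef_poly ltnN. Qed.

Lemma egf_count N G n :
  (n < N)%N -> (sp_count G n)%:R = (egf N G)`_n * n`!%:R.
Proof. by move=> ltnN; rewrite coef_egf // divfK ?fact_neq0. Qed.

Lemma count_conv G H n :
  (\sum_(A : {set 'I_n}) sp_count G #|A| * sp_count H #|~: A|)%N%:R / n`!%:R =
  \sum_(j < n.+1) (sp_count G j)%:R / j`!%:R *
    ((sp_count H (n - j))%:R / (n - j)`!%:R) :> rat.
Proof.
have := sum_subsets_conv [set: 'I_n] (fun j => (sp_count G j)%:R : rat)
  (fun j => (sp_count H j)%:R).
rewrite cardsT card_ord => <-; rewrite natr_sum; congr (_ / _).
by apply: eq_big => [A|A _]; rewrite ?subsetT // natrM setTD.
Qed.

Lemma egf_prod N G H :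
  eq_upto N (egf N (sp_prod G H)) (egf N G * egf N H).
Proof.
move=> n ltnN; rewrite coef_egf // /sp_count card_prod_species count_conv coefM.
apply: eq_bigr => j _; rewrite !coef_egf //.
  exact: leq_ltn_trans (leq_subr _ _) ltnN.
by apply: leq_ltn_trans ltnN; rewrite -ltnS.
Qed.

Lemma count_unit n : sp_count sp_unit n = 1%N.
Proof. exact: card_unit. Qed.

Lemma egf_one N : eq_upto N (egf N sp_one) 1.
Proof.
move=> n ltnN; rewrite coef_egf // coef1 count_restr count_unit.
by case: eqP => [->|_]; rewrite ?mul0r ?fact0 ?divr1.
Qed.

Lemma egf_X N : eq_upto N (egf N sp_X) 'X.
Proof.
move=> n ltnN; rewrite coef_egf // coefX count_restr count_unit.
by case: eqP => [->|_]; rewrite ?mul0r ?divr1.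
Qed.

Lemma egf_pow N G k : eq_upto N (egf N (sp_pow G k)) (egf N G ^+ k).
Proof.
elim: k => [|k IHk] n ltnN; first by rewrite expr0 egf_one.
rewrite exprS egf_prod //.
by apply: (@eq_uptoM N) ltnN.
Qed.

(** Grouping the partitions by their number [k] of blocks, the factor [sp_count G k] is [k!] times a
    coefficient of [egf N G], and this [k!] is the one in [partition_weight_coef]. *)
Lemma egf_compose N G H :
  sp_count H 0 = 0%N ->
  eq_upto N (egf N (sp_compose G H)) (egf N G \Po egf N H).
Proof.
move=> H0; case: N => [//|N] n ltnN.
rewrite coef_egf // /sp_count card_compose natr_sum.
pose h j : rat := (sp_count H j)%:R.
(* A partition of [n] points has at most [n < N.+1] blocks, so [inord] does not change the block
   count. *)
rewrite (partition_big (fun P : {set {set 'I_n}} => inord #|P|)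
  (fun k : 'I_N.+1 => true)) //= coef_comp_poly mulr_suml.
have lePn (P : {set {set 'I_n}}) : partition P [set: 'I_n] -> (#|P| <= n)%N.
  by move/leq_card_blocks; rewrite cardsT card_ord.
transitivity (\sum_(k < N.+1) (egf N.+1 G)`_k * (egf N.+1 H ^+ k)`_n).
  apply: eq_bigr => k _.
  have := @partition_weight_coef rat h (egf N.+1 H) N.+1 'I_n _ _ k [set: 'I_n].
  rewrite cardsT card_ord => <- //; first last.
  - by move=> j ltjN; rewrite coef_egf.
  - by rewrite /h H0.
  rewrite coef_egf // /partition_weight.
  have -> : \sum_(P : {set {set 'I_n}} |
        partition P [set: 'I_n] && (inord #|P| == k))
      (sp_count G #|P| * \prod_(B in P) sp_count H #|B|)%:R =
      (sp_count G k)%:R * \sum_(P : {set {set 'I_n}} |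
        partition P [set: 'I_n] && (#|P| == k))
        \prod_(B in P) h #|B|.
    rewrite mulr_sumr; apply: eq_big => [P|P /andP[pP /eqP kE]].
      apply: andb_id2l => pP; rewrite -val_eqE /= inordK //.
      exact: leq_ltn_trans (lePn P pP) ltnN.
    move/(congr1 val): kE; rewrite /= inordK => [kE|]; last first.
      exact: leq_ltn_trans (lePn P pP) ltnN.
    by rewrite natrM natr_prod kE.
  by move: (fact_neq0 rat k) (fact_neq0 rat n) => h1 h2; field; rewrite h1 h2.
pose a k : rat := (egf N.+1 G)`_k * (egf N.+1 H ^+ k)`_n.
rewrite [RHS](big_ord_widen N.+1 a) ?size_poly // [RHS]big_mkcond.
apply: eq_bigr => k _; case: ifPn => //.
by rewrite -leqNgt /a => /leq_sizeP->; rewrite ?mul0r.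
Qed.

Lemma egf_treelike N F :
  eq_upto N (egf N (treelike F)) (egf N F \Po ('X * egf N (treelike F))).
Proof.
move=> n ltnN; have -> : (egf N (treelike F))`_n =
    (egf N (sp_compose F (sp_prod sp_X (treelike F))))`_n.
  by rewrite !coef_egf // /sp_count (card_iso _ (treelikeE F)).
rewrite egf_compose //; last first.
  (* The factor ['X] kills the constant term of [X.T], as composition requires. *)
  apply/eqP; rewrite -(@eqr_nat rat) (@egf_count 1) // egf_prod //.
  by rewrite coef0M egf_X // coefX !mul0r.
apply: eq_upto_comp ltnN => i ltiN; rewrite egf_prod //.
by apply: eq_uptoM ltiN => //; exact: egf_X.
Qed.

(* Coefficientwise form of T^c = F^c(X.T) = sum_m [x^m]F^c . X^m . T^m, which is
   the recursion defining the parking-like species. *)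
Lemma egf_treelike_pow N F c n :
  let t := egf N (treelike F) in (n < N)%N ->
  (t ^+ c)`_n = \sum_(m < n.+1) (egf N F ^+ c)`_m * (t ^+ m)`_(n - m).
Proof.
(* Composition on the right is a ring morphism, so the [c]-th power passes to the outer series. *)
move=> t ltnN; rewrite (eq_uptoX c (@egf_treelike N F)) // -rmorphXn /=.
rewrite -/t coef_comp_poly; set f := egf N F ^+ c.
pose a m := f`_m * (('X * t) ^+ m)`_n.
(* Both sums are extended to a common range: [f] has no coefficient from [size f] on, and ['X^m]
   divides the [m]-th power, which kills the terms with [m > n]. *)
transitivity (\sum_(m < maxn (size f) n.+1) a m).
  rewrite (big_ord_widen _ a (leq_maxl _ n.+1)) big_mkcond.
  apply: eq_bigr => m _; case: ifPn => //.
  by rewrite -leqNgt /a => /leq_sizeP->; rewrite ?mul0r.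
rewrite (big_ord_widen _ (fun m => f`_m * (t ^+ m)`_(n - m))
  (leq_maxr (size f) n.+1)).
rewrite [RHS]big_mkcond; apply: eq_bigr => m _.
by rewrite /a exprMn coefXnM ltnS ltnNge; case: leqP => // _; rewrite mulr0.
Qed.

(** Strong induction on [n], with [c] and [chi] general because the recursion replaces [c] by the
    size of the chosen part. That part is nonempty, so fewer points remain. *)
Lemma count_parking N F n : (n < N)%N -> forall c chi,
  (forall k, chi k.+1 = c + k)%N ->
  (sp_count (parking F chi) n)%:R = (egf N (treelike F) ^+ c)`_n * n`!%:R.
Proof.
elim/ltn_ind: n => n IHn ltnN c chi chiE.
have N_gt0 : (0 < N)%N := leq_ltn_trans (leq0n n) ltnN.
have chi1 : chi 1%N = c by rewrite chiE addn0.
apply: (canRL (divfK (fact_neq0 rat n))).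
rewrite egf_treelike_pow // /sp_count card_parking card_ord chi1 natrD mulrDl.
rewrite big_ord_recl; congr (_ + _).
  (* The term [m = 0] involves [t ^+ 0 = 1], so it survives only at [n = 0], exactly like the
     restriction to size 0. *)
  rewrite count_restr subn0 expr0 coef1 -egf_pow //.
  case: eqP => [->|_]; last by rewrite mulr0 mul0r.
  by rewrite [RHS]mulr1 (coef_egf _ N_gt0).
rewrite natr_sum mulr_suml; apply: eq_bigr => m _.
have lemN : (m.+1 < N)%N by apply: leq_ltn_trans ltnN.
rewrite count_conv.
(* The restriction keeps only the subsets of size [m.+1], the value of [lift ord0 m]. *)
rewrite (bigD1 (lift ord0 m)) //= big1 ?addr0 => [|j jm]; last first.
  rewrite count_restr; case: eqP => [jE|_]; last by rewrite !mul0r.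
  by case/eqP: jm; apply: val_inj.
rewrite /bump /= add1n count_restr eqxx -egf_pow // coef_egf //.
congr (_ * _).
rewrite (IHn _ _ _ m.+1) ?mulfK ?fact_neq0 //.
- by rewrite ltn_subrL (leq_ltn_trans _ (ltn_ord m)).
- exact: leq_ltn_trans (leq_subr _ _) ltnN.
(* Subtracting [chi 1 = c] cancels [c]: the new sequence is again of the required form, with
   constant [m.+1]. *)
- by move=> k; rewrite /rho addnS chiE chi1 addKn.
Qed.

End GeneratingFunctions.

Theorem theorem2 (F : species) (U : finType) :
  exists f : parking F id U -> treelike F U, bijective f.
Proof.
have cE : #|parking F id U| = #|treelike F U|.
  rewrite !card_species; apply/eqP; rewrite -(@eqr_nat rat).
  (* The identity sends [k.+1] to [1 + k], hence [c = 1]; order [#|U|.+1] is enough to retain the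
     coefficient of index [#|U|]. *)
  rewrite (@count_parking #|U|.+1 F _ (ltnSn _) 1) //.
  by rewrite expr1 -egf_count.
exists (fun x => enum_val (cast_ord cE (enum_rank x))).
exists (fun y => enum_val (cast_ord (esym cE) (enum_rank y))) => x.
- by rewrite enum_valK cast_ordK enum_rankK.
- by rewrite enum_valK cast_ordKV enum_rankK.
Qed.
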